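(* Two finite abelian groups $G$ and $H$ of the same order are isomorphic if and only if they have the same product of element orders, i.e. if $|G|=|H|$, then $G\cong H$ if and only if $\psi'(G)=\psi'(H)$.
   Context: For a finite group $G$, $\psi'(G)=\prod_{x\in G}o(x)$ denotes the product of the orders of all elements of $G$, where $o(x)$ is the order of $x\in G$. *)

(* Defs.v *)
From mathcomp Require Import all_boot all_fingroup.

Set Implicit Arguments.
Unset Strict Implicit.
Unset Printing Implicit Defensive.

Local Open Scope group_scope.

(* The product is taken in nat, not in the group scope. *)
Definition psi_prod (gT : finGroupType) (A : {set gT}) : nat :=
  (\prod_(x in A) #[x])%N.

(* Main.v *)
(* Let N = #|G|, fix a prime p, and let a_i be the p-exponents of the invariant
   factors of G.  The elements x of G with v_p(o(x)) <= k form a subgroup of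
   order N_{p'} p^(S k), where S k = sum_i min(k, a_i).  Hence
     v_p(psi'(G)) = sum_k (N - N_{p'} p^(S k)),
   so psi'(G) and N determine sum_{k < K} p^(S k) for every large K.  Since S
   increases strictly until it reaches v_p(N), this sum determines S: if S and T
   have equal sums and first differ at k, with S k < T k, then every remaining
   term but p^(S k) is divisible by p^(S k + 1).  Finally, the functions S for
   all p determine the invariant factors. *)
Require Import Defs.
From mathcomp Require Import all_boot all_fingroup all_solvable.
From mathcomp Require Import zify.

(** * Parts and valuations of products *)

Lemma partn_bigprod (I : Type) (r : seq I) (P : pred I) (F : I -> nat) pi :
  (forall i, P i -> 0 < F i) ->
  ((\prod_(i <- r | P i) F i)`_pi = \prod_(i <- r | P i) (F i)`_pi)%N.
Proof.
move=> F_gt0; suffices []: 0 < \prod_(i <- r | P i) F i /\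
  ((\prod_(i <- r | P i) F i)`_pi = \prod_(i <- r | P i) (F i)`_pi)%N by [].
elim/big_ind2: _ => [|x m y n [x_gt0 <-] [y_gt0 <-]|i /F_gt0]; rewrite ?partn1 //.
by rewrite muln_gt0 x_gt0 partnM.
Qed.

Lemma sum_nat_leq l K : \sum_(0 <= k < K) (l <= k) = K - l.
Proof.
elim: K => [|K IHK]; first by rewrite big_geq.
by rewrite big_nat_recr //= IHK; lia.
Qed.

Lemma logn_bigprod (I : Type) (r : seq I) (P : pred I) (F : I -> nat) p :
  (forall i, P i -> 0 < F i) ->
  logn p (\prod_(i <- r | P i) F i)%N = (\sum_(i <- r | P i) logn p (F i))%N.
Proof.
move=> F_gt0; suffices []: 0 < (\prod_(i <- r | P i) F i)%N /\
  logn p (\prod_(i <- r | P i) F i)%N = (\sum_(i <- r | P i) logn p (F i))%N by [].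
elim/big_ind2: _ => [|x m y n [x_gt0 <-] [y_gt0 <-]|i /F_gt0]; rewrite ?logn1 //.
by rewrite muln_gt0 x_gt0 lognM.
Qed.

(** * Truncated exponent sums and the invariant factors they determine *)

(** This is the function S of the overview when [t] lists the invariant factors. *)
Definition trunc_logn_sum p (t : seq nat) k := (\sum_(m <- t) minn k (logn p m))%N.

Lemma trunc_logn_sum_cons p m t k :
  trunc_logn_sum p (m :: t) k = minn k (logn p m) + trunc_logn_sum p t k.
Proof. exact: big_cons. Qed.

Lemma trunc_logn_sum_le p t k :
  trunc_logn_sum p t k <= \sum_(m <- t) logn p m.
Proof. by apply: leq_sum => m _; apply: geq_minr. Qed.

Lemma eq_trunc_logn_sum p t k :
  (trunc_logn_sum p t k == \sum_(m <- t) logn p m)%N = all (fun m => logn p m <= k) t.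
Proof.
elim: t => [|m t IHt] /=; first by rewrite /trunc_logn_sum !big_nil.
rewrite -IHt trunc_logn_sum_cons big_cons; move: (trunc_logn_sum_le p t k); lia.
Qed.

Lemma leq_trunc_logn_sum p t : {homo trunc_logn_sum p t : j k / j <= k}.
Proof. by move=> j k jk; apply: leq_sum => m _; lia. Qed.

Lemma ltn_trunc_logn_sum p t k :
  trunc_logn_sum p t k < \sum_(m <- t) logn p m ->
  trunc_logn_sum p t k < trunc_logn_sum p t k.+1.
Proof.
elim: t => [|m t IHt]; first by rewrite big_nil.
rewrite !trunc_logn_sum_cons big_cons; move: (leq_trunc_logn_sum p t k k.+1 (leqnSn k)).
move: (trunc_logn_sum_le p t k); lia.
Qed.

(** As [n] is a multiple of all of [t], the sum for [n :: t] has reached its final value at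
    [k = logn p n]. Then so has the sum for [m :: s], which forces [logn p m <= logn p n]. *)
Lemma dvd_trunc_logn_sum s t m n :
  0 < m -> 0 < n -> path (fun a b => b %| a) n t ->
  (forall p k, prime p ->
    trunc_logn_sum p (m :: s) k = trunc_logn_sum p (n :: t) k) ->
  m %| n.
Proof.
move=> m_gt0 n_gt0 pt eqst; apply/dvdn_partP => // p; rewrite mem_primes => /and3P[p_pr _ _].
rewrite p_part pfactor_dvdn //; set a := logn p n.
have total r : exists K, forall k, K <= k -> trunc_logn_sum p r k = (\sum_(i <- r) logn p i)%N.
  exists (\max_(i <- r) logn p i) => k Kk; apply/eqP; rewrite eq_trunc_logn_sum.
  by apply/allP=> i ir; apply: leq_trans Kk; apply: (@leq_bigmax_seq _ r xpredT (logn p) i).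
have [Ks totals] := total (m :: s); have [Kt totalt] := total (n :: t).
(* At [Ks + Kt] both sums are final, so the two totals agree. *)
have: trunc_logn_sum p (m :: s) a == (\sum_(i <- m :: s) logn p i)%N.
  rewrite -(totals (Ks + Kt)) ?leq_addr // !eqst // (totalt (Ks + Kt)) ?leq_addl //.
  rewrite eq_trunc_logn_sum; apply/allP=> i.
  rewrite inE => /predU1P[-> //|it]; apply: dvdn_leq_log => //.
  have tr: transitive (fun a b : nat => b %| a) by move=> x y z xy yz; apply: dvdn_trans xy.
  by have /allP/(_ i it) := order_path_min tr pt.
by rewrite eq_trunc_logn_sum /= => /andP[].
Qed.

(** The heads divide each other, hence are equal; their terms cancel and induction handles the
    tails. *)
Lemma trunc_logn_sum_inj s t :
  all (fun m => 1 < m) s -> all (fun m => 1 < m) t ->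
  sorted (fun a b => b %| a) s -> sorted (fun a b => b %| a) t ->
  (forall p k, prime p -> trunc_logn_sum p s k = trunc_logn_sum p t k) -> s = t.
Proof.
(* Rules out lists of different lengths: for a prime divisor of [n], the right sum is already
   positive at 1. *)
have nil_inj n r : 1 < n -> (forall p k, prime p ->
    trunc_logn_sum p [::] k = trunc_logn_sum p (n :: r) k) -> False.
  move=> n_gt1 /(_ (pdiv n) 1 (pdiv_prime n_gt1)).
  rewrite trunc_logn_sum_cons /trunc_logn_sum big_nil.
  have : 0 < logn (pdiv n) n by rewrite logn_gt0 mem_primes pdiv_prime // pdiv_dvd ltnW.
  lia.
elim: s t => [|m s IHs] [|n t] //=.
- by move=> _ /andP[n1 _] _ _ /nil_inj; case/(_ n1).
- by move=> /andP[m1 _] _ _ _ eqst; case: (nil_inj m s m1) => p k /eqst->.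
move=> /andP[m1 s1] /andP[n1 t1] ps pt eqst.
have emn : m = n.
  apply/eqP; rewrite eqn_dvd (dvd_trunc_logn_sum s t) ?(dvd_trunc_logn_sum t s) 1?ltnW //.
  by move=> p k /eqst->.
rewrite emn in eqst *; congr (_ :: _); apply: IHs => //.
- exact: path_sorted ps.
- exact: path_sorted pt.
move=> p k /(eqst p k); rewrite !trunc_logn_sum_cons; exact: addnI.
Qed.

(** * Recovering exponents from a sum of powers *)

Lemma eq_sum_expn p n K (S T : nat -> nat) :
  1 < p -> {homo S : j k / j <= k} -> {homo T : j k / j <= k} ->
  (forall k, S k <= n) -> (forall k, T k <= n) ->
  (forall k, S k < n -> S k < S k.+1) -> (forall k, T k < n -> T k < T k.+1) ->
  (\sum_(0 <= k < K) p ^ S k = \sum_(0 <= k < K) p ^ T k)%N ->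
  forall k, k < K -> S k = T k.
Proof.
move=> p_gt1 S_homo T_homo leSn leTn incS incT eqST k.
have [m] := ubnP k; elim: m k => // m IHm k ltkm ltkK.
have {}IHm j : j < k -> S j = T j by move=> ltjk; apply: IHm; lia.
have {eqST} tail : (\sum_(k <= j < K) p ^ S j = \sum_(k <= j < K) p ^ T j)%N.
  move: eqST; rewrite !(big_cat_nat (leq0n k) (ltnW ltkK)) /=.
  rewrite (@eq_big_nat _ _ _ 0 k _ (fun j => p ^ T j)%N); first by move/addnI.
  by move=> j /andP[_ /IHm->].
wlog ltST : S T leSn leTn S_homo T_homo incS incT tail IHm / S k < T k.
  case: (ltngtP (S k) (T k)) => // lt wl; first exact: wl.
  by symmetry; apply: (wl T S) => // j /IHm.
(* Every exponent in the tail for [T] is at least [T k], which exceeds [S k]. *)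
have: p ^ (S k).+1 %| \sum_(k <= j < K) p ^ S j.
  rewrite tail big_nat; apply: dvdn_sum => j /andP[lekj _].
  by rewrite dvdn_exp2l // (leq_trans ltST) // T_homo.
(* Since [S k < T k <= n], [S] increases strictly at [k], so all terms after the first are divisible
   too; the first is not. *)
rewrite big_ltn // dvdn_addl; last first.
  rewrite big_nat; apply: dvdn_sum => j /andP[ltkj _].
  rewrite dvdn_exp2l // (leq_trans (incS k _)) ?(leq_trans ltST) //.
  exact: S_homo.
by rewrite dvdn_Pexp2l // ltnn.
Qed.

(** * Solutions of x^n = 1 in abelian groups *)

Local Open Scope group_scope.

Lemma psi_prod_isog (gT rT : finGroupType) (G : {group gT}) (H : {group rT}) :
  G \isog H -> psi_prod G = psi_prod H.
Proof.
case/isogP=> f injf <-; rewrite /psi_prod morphimEdom big_imset; last exact/injmP.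
by apply: eq_bigr => x Gx; rewrite order_injm.
Qed.

(** The solutions form the cyclic subgroup generated by [x ^+ (#[x] %/ g)], with [g] the gcd. *)
Lemma card_Ldiv_cycle (gT : finGroupType) (x : gT) n :
  #|'Ldiv_n(<[x]>)| = gcdn n #[x].
Proof.
set g := gcdn n #[x]; have g_gt0: 0 < g by rewrite gcdn_gt0 order_gt0 orbT.
have gx: g %| #[x] by apply: dvdn_gcdr.
have gn: g %| n by apply: dvdn_gcdl.
suffices ->: 'Ldiv_n(<[x]>) = <[x ^+ (#[x] %/ g)]>.
  rewrite -orderE orderXdiv ?dvdn_div //.
  by rewrite divnA // mulKn.
apply/setP=> y; apply/LdivP/idP=> [[/cycleP[i ->] /eqP]|].
  rewrite -expgM -order_dvdn => dv.
  suffices /dvdnP[j ->]: #[x] %/ g %| i by rewrite mulnC expgM mem_cycle.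
  have co: coprime (#[x] %/ g) (n %/ g).
    rewrite /coprime -(eqn_pmul2r g_gt0) mul1n muln_gcdl !divnK //.
    by rewrite gcdnC.
  rewrite -(Gauss_dvdl _ co) -(dvdn_pmul2r g_gt0) divnK //.
  by rewrite -mulnA divnK.
case/cycleP=> i ->; rewrite -!expgM; split; first exact: mem_cycle.
apply/eqP; rewrite -order_dvdn.
rewrite -{1}(divnK gx) -mulnA dvdn_mul // (dvdn_trans gn) //.
by rewrite dvdn_mull.
Qed.

Lemma card_Ldiv_dprod (gT : finGroupType) (A B G : {group gT}) n :
  A \x B = G -> abelian G -> #|'Ldiv_n(G)| = (#|'Ldiv_n(A)| * #|'Ldiv_n(B)|)%N.
Proof.
move=> defG cGG; have [_ defAB cAB tiAB] := dprodP defG.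
have sAG: A \subset G by rewrite -defAB mulG_subl.
have sBG: B \subset G by rewrite -defAB mulG_subr.
pose LA := Group (group_Ldiv n (abelianS sAG cGG)).
pose LB := Group (group_Ldiv n (abelianS sBG cGG)).
rewrite -(@TI_cardMg _ LA LB) /=; last first.
  by rewrite setIACA tiAB; apply/setIidPl; rewrite sub1set !inE expg1n eqxx.
congr #|pred_of_set _|; apply/setP=> y; apply/LdivP/mulsgP.
  rewrite -defAB => -[/mulsgP[a b Aa Bb ->] abn].
  have cab: commute a b by apply: (centsP (sub_abelian_cent2 cGG sAG sBG)).
  rewrite expgMn // in abn.
  (* The inverse of [a ^+ n] is [b ^+ n], so [a ^+ n] lies in the trivial intersection of [A] and
     [B]. *)
  have an1: a ^+ n = 1.
    apply/set1gP; rewrite /= -[[1]]tiAB inE groupX //=.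
    rewrite -[a ^+ n]invgK groupV (_ : _^-1 = b ^+ n) ?groupX //.
    by apply/eqP; rewrite eq_invg_mul abn.
  by exists a b => //; apply/LdivP; split=> //; rewrite an1 mul1g in abn.
case=> a b /LdivP[Aa an1] /LdivP[Bb bn1] ->; split.
  by rewrite -defAB mem_mulg.
have cab: commute a b by apply: (centsP (sub_abelian_cent2 cGG sAG sBG)).
by rewrite expgMn // an1 bn1 mulg1.
Qed.

Lemma card_Ldiv_abelian (gT : finGroupType) (G : {group gT}) n :
  abelian G -> #|'Ldiv_n(G)| = (\prod_(m <- abelian_type G) gcdn n m)%N.
Proof.
move=> cGG; have [b defG <-] := abelian_structure cGG; rewrite big_map.
elim: b G cGG defG => [|x b IHb] G cGG.
  rewrite !big_nil => <-; rewrite (_ : 'Ldiv_n(1) = 1) ?cards1 //.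
  by apply/setP=> y; rewrite !inE; case: eqP => // ->; rewrite expg1n eqxx.
rewrite !big_cons => defG; case/dprodP: (defG) => [[_ H _ defH] defxH _ _].
rewrite defH in defG defxH.
rewrite (card_Ldiv_dprod _ _ _ _ _ defG cGG) card_Ldiv_cycle (IHb H) //.
by apply: abelianS cGG; rewrite -defxH mulG_subr.
Qed.

(** The case n = 0 of [card_Ldiv_abelian]: every x satisfies x^0 = 1, and gcd(0, m) = m. *)
Lemma card_abelian_type (gT : finGroupType) (G : {group gT}) :
  abelian G -> #|G| = (\prod_(m <- abelian_type G) m)%N.
Proof.
move=> cGG; rewrite -[RHS](eq_bigr _ (fun m _ => gcd0n m)).
rewrite -card_Ldiv_abelian //; congr #|pred_of_set _|; apply/setP=> x.
by rewrite !inE expg0 eqxx andbT.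
Qed.

Lemma sum_logn_abelian_type (gT : finGroupType) (G : {group gT}) p :
  abelian G -> (\sum_(m <- abelian_type G) logn p m)%N = logn p #|G|.
Proof.
move=> cGG; rewrite card_abelian_type // big_seq [in RHS]big_seq logn_bigprod // => m.
by move/(allP (abelian_type_gt1 G))/ltnW.
Qed.

(** * The valuation of psi' and the theorem *)

(** With [c] the p'-part of [#|G|], the condition on x says that its order divides [p ^ k * c]. For
    an invariant factor m, the gcd of [p ^ k * c] and m has p-part [p ^ minn k (logn p m)] and the
    same p'-part as m, which divides [c]. *)
Lemma card_logn_order_leq (gT : finGroupType) (G : {group gT}) p k :
  abelian G -> prime p ->
  #|[set x in G | logn p #[x] <= k]| =
    (#|G|`_p^' * p ^ trunc_logn_sum p (abelian_type G) k)%N.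
Proof.
move=> cGG p_pr; set t := abelian_type G.
set c := (#|G|`_p^')%N; have c_gt0: 0 < c by apply: part_gt0.
have lognc0: logn p c = 0%N.
  by rewrite -logn_part part_p'nat ?part_pnat // logn1.
have lognc: logn p (p ^ k * c)%N = k.
  by rewrite lognM ?expn_gt0 ?(prime_gt0 p_pr) // pfactorK // lognc0 addn0.
transitivity #|'Ldiv_(p ^ k * c)(G)|.
  congr #|pred_of_set _|; apply/setP=> x; rewrite !inE -order_dvdn.
  apply: andb_id2l => Gx; apply/idP/idP=> [le_k|/(dvdn_leq_log p)].
    rewrite -(partnC p (order_gt0 x)) p_part dvdn_mul ?dvdn_exp2l //.
    by rewrite partn_dvd ?order_dvdG.
  by rewrite lognc; apply; rewrite muln_gt0 expn_gt0 (prime_gt0 p_pr).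
rewrite card_Ldiv_abelian // -/t.
have tP m : m \in t -> (0 < m)%N /\ m`_p^' %| c.
  move=> tm; split; first exact: ltnW (allP (abelian_type_gt1 G) m tm).
  rewrite partn_dvd // card_abelian_type // -/t (big_rem m) //=.
  exact: dvdn_mulr.
rewrite {2}/c card_abelian_type // -/t big_seq [in RHS]big_seq.
rewrite partn_bigprod; last by move=> m /tP[].
rewrite -!big_seq /trunc_logn_sum expn_sum -big_split /= !big_seq.
apply: eq_bigr => m /tP[m_gt0 mc].
have pkc_gt0 : 0 < p ^ k * c by rewrite muln_gt0 expn_gt0 (prime_gt0 p_pr).
have g_gt0 : 0 < gcdn (p ^ k * c) m by rewrite gcdn_gt0 m_gt0 orbT.
rewrite -(partnC p g_gt0) p_part logn_gcd // lognc mulnC; congr (_ * _)%N.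
rewrite partn_gcd // partnM ?expn_gt0 ?(prime_gt0 p_pr) //.
rewrite part_p'nat ?pnatNK ?pnatX ?pnat_id // mul1n.
by rewrite part_pnat_id ?part_pnat //; apply/gcdn_idPr.
Qed.

(** Double counting of the pairs (x, k) with [logn p #[x] <= k < K]: each x lies in [K - logn p
    #[x]] of them. The additive form avoids truncated subtraction. *)
Lemma logn_psi_prod (gT : finGroupType) (G : {group gT}) p K :
  abelian G -> prime p -> #|G| <= K ->
  (logn p (psi_prod G)
     + #|G|`_p^' * \sum_(0 <= k < K) p ^ trunc_logn_sum p (abelian_type G) k
   = #|G| * K)%N.
Proof.
move=> cGG p_pr leGK; rewrite logn_bigprod => [|x _]; last exact: order_gt0.
rewrite big_distrr /= -(eq_bigr _ (fun k _ => card_logn_order_leq gT G p k cGG p_pr)).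
have -> : (\sum_(0 <= k < K) #|[set x in G | logn p #[x] <= k]|
          = \sum_(x in G) \sum_(0 <= k < K) (logn p #[x] <= k))%N.
  rewrite exchange_big; apply: eq_bigr => k _ /=.
  by rewrite -sum1_card -big_mkcondr /=; apply: eq_bigl => x; rewrite inE.
rewrite -big_split /= -sum_nat_const; apply: eq_bigr => x Gx.
(* The subtraction is exact because [logn p #[x] < #[x] <= #|G| <= K]. *)
rewrite sum_nat_leq subnKC // (leq_trans _ leGK) //.
by rewrite (leq_trans (ltnW (ltn_logl _ _))) ?order_gt0 // dvdn_leq ?order_dvdG.
Qed.

Theorem theoremE (gT rT : finGroupType) (G : {group gT}) (H : {group rT})
    (abG : abelian G) (abH : abelian H) (eqGH : #|G| = #|H|) :
  G \isog H <-> psi_prod G = psi_prod H.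
Proof.
split=> [|eq_psi]; first exact: psi_prod_isog.
rewrite eq_abelian_type_isog //; apply/eqP.
apply: trunc_logn_sum_inj; rewrite ?abelian_type_gt1 ?abelian_type_dvdn_sorted //.
(* [K] is at least [#|G|], as [logn_psi_prod] requires, and exceeds [k], so that [eq_sum_expn]
   reaches [k]. *)
move=> p k p_pr; pose K := (#|G| + k.+1)%N.
apply: (eq_sum_expn p (logn p #|G|) K); rewrite ?prime_gt1 //.
- exact: leq_trunc_logn_sum.
- exact: leq_trunc_logn_sum.
- by move=> j; rewrite -sum_logn_abelian_type // trunc_logn_sum_le.
- by move=> j; rewrite eqGH -sum_logn_abelian_type // trunc_logn_sum_le.
- by move=> j; rewrite -sum_logn_abelian_type //; apply: ltn_trunc_logn_sum.
- by move=> j; rewrite eqGH -sum_logn_abelian_type //; apply: ltn_trunc_logn_sum.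
- have := logn_psi_prod _ G p K abG p_pr (leq_addr _ _).
  have := logn_psi_prod _ H p K abH p_pr; rewrite -eqGH => /(_ (leq_addr _ _)) <-.
  by rewrite eq_psi => /addnI/eqP; rewrite eqn_pmul2l ?part_gt0 // => /eqP.
by rewrite /K addnS ltnS leq_addl.
Qed.
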